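(* Assume the Axiom of Choice. Let $X$ be an uncountable Polish space. Then there is a map $\psi\colon\mathscr P(\omega)\to\mathscr P(X)$ such that for all $a,b\subseteq\omega$: (1) if $a\subseteq b$ then $\psi(a)\le_{\mathsf D_2(X)}\psi(b)$; (2) if $\psi(a)\le_{\mathsf{Bor}(X)}\psi(b)$ then $a\subseteq b$. In particular, $(\mathscr P(\omega),\subseteq)$ embeds into the $\mathcal F$-hierarchy on $X$ for every reducibility $\mathcal F$ with $\mathsf D_2(X)\subseteq\mathcal F\subseteq\mathsf{Bor}(X)$, and hence the $\mathcal F$-hierarchy on all subsets of $X$ is very bad.
   Context: $\mathsf D_2(X)$ is the set of $\boldsymbol\Delta^0_2$-functions $f\colon X\to X$, i.e. those with $f^{-1}(A)\in\boldsymbol\Sigma^0_2$ for every $A\in\boldsymbol\Sigma^0_2$; $\mathsf{Bor}(X)$ is the set of Borel measurable maps $X\to X$. A reducibility is a set of self-maps of $X$ closed under composition containing the identity; $A\le_{\mathcal F}B$ iff $A=f^{-1}(B)$ for some $f\in\mathcal F$. The $\mathcal F$-hierarchy is the quotient of $(\mathscr P(X),\le_{\mathcal F})$; very bad means it contains both an infinite antichain and an infinite strictly descending chain. *)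

(* Defs.v *)
From HB Require Import structures.
From mathcomp Require Import all_boot all_order all_algebra.
From mathcomp Require Import all_classical all_reals all_analysis.
From mathcomp Require Import borel_hierarchy.

Set Implicit Arguments.
Unset Strict Implicit.
Unset Printing Implicit Defensive.

Import Order.TTheory GRing.Theory Num.Theory.

Local Open Scope classical_set_scope.

Definition homeomorphic (X Y : topologicalType) : Prop :=
  exists (h : X -> Y) (g : Y -> X),
    [/\ cancel h g, cancel g h, continuous h & continuous g].

Definition complete_metric (R : realType) (M : metricType R) : Prop :=
  forall u : nat -> M, cauchy (u @ \oo) -> exists l : M, u @ \oo --> l.

Definition separable_space (X : topologicalType) : Prop :=
  exists2 D : set X, countable D & dense D.

Definition polish_space (R : realType) (X : topologicalType) : Prop :=
  separable_space X /\
  exists M : metricType R, complete_metric M /\ homeomorphic X M.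

(* In a metrizable space the boldface class Sigma^0_2 is, by definition, the
   class of countable unions of closed sets. *)
Definition D2 (X : topologicalType) : set (X -> X) :=
  [set f | forall A : set X, Fsigma A -> Fsigma (f @^-1` A)].

Definition borel_set (X : topologicalType) : set (set X) :=
  <<s [set U : set X | open U] >>.

Definition Bor (X : topologicalType) : set (X -> X) :=
  [set f | forall A : set X, borel_set A -> borel_set (f @^-1` A)].

Definition is_reducibility (X : Type) (F : set (X -> X)) : Prop :=
  F id /\ forall f g : X -> X, F f -> F g -> F (f \o g).

Definition reducible (X : Type) (F : set (X -> X)) (A B : set X) : Prop :=
  exists2 f : X -> X, F f & A = f @^-1` B.

Definition degree_of (X : Type) (F : set (X -> X)) (A : set X) :
    set (set X) :=
  [set B | reducible F A B /\ reducible F B A].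

(* The quotient of the preorder [reducible F] on the powerset of X, realized
   as the type of its equivalence classes. *)
Definition hierarchy (X : Type) (F : set (X -> X)) : Type :=
  {p : set (set X) | exists A : set X, p = degree_of F A}.

Definition degree_le (X : Type) (F : set (X -> X)) (p q : hierarchy F) : Prop :=
  exists A B : set X, [/\ sval p A, sval q B & reducible F A B].

Definition order_embeds (T U : Type) (leT : T -> T -> Prop)
    (leU : U -> U -> Prop) : Prop :=
  exists f : T -> U, injective f /\ forall x y, leT x y <-> leU (f x) (f y).

Definition has_infinite_antichain (T : Type) (le : T -> T -> Prop) : Prop :=
  exists S : set T, infinite_set S /\
    forall x y, S x -> S y -> x <> y -> ~ le x y.

Definition has_infinite_descending_chain (T : Type) (le : T -> T -> Prop) :
    Prop :=
  exists s : nat -> T, forall n, le (s n.+1) (s n) /\ ~ le (s n) (s n.+1).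

Definition very_bad (T : Type) (le : T -> T -> Prop) : Prop :=
  has_infinite_antichain le /\ has_infinite_descending_chain le.

(* Main.v *)
Require Import Defs.
From mathcomp Require Import all_boot all_order all_algebra.
From mathcomp Require Import all_classical all_reals all_analysis.
From mathcomp Require Import borel_hierarchy wochoice.
From Stdlib Require Wellfounded.

(** Let [C] be the set of condensation points of [X], and let [U 0, U 1, ...]
    be pairwise disjoint open sets meeting [C].  We take
    [psi a := Y `&` \bigcup_(n in a) U n.+1] for a suitable set [Y].  If [a] is
    a subset of [b], the map that is the identity on the open set
    [\bigcup_(n in a) U n.+1] and constant, with value a point of [U 0],
    elsewhere is a Delta^0_2 reduction, whatever [Y] is.

    A Borel map [f] is continuous on a relatively comeager G_delta subset [G] of
    [C], and the restriction of [f] to [G] is coded by countably many open sets,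
    so there are only continuum many such restrictions.  For each of them and
    each [n], a Cantor scheme yields injective families [p] and [q] indexed by
    [2^omega], with [p] valued in [G `&` U n.+1], such that either [q = f \o p],
    or [q] avoids [p] inside [G `&` U n.+1] and [f \o q = f \o p].  By a
    transfinite recursion of length continuum we choose one index in each family
    so that the [q]-point of a family is never the [p]-point of another one, and
    we let [Y] be the set of the chosen [p]-points.  If [f] reduced [psi a] to
    [psi b] with [n] in [a] but not in [b], the pair of points chosen for [f]
    and [n] would give a contradiction. *)

Import Order.TTheory GRing.Theory Num.Theory.

Local Open Scope classical_set_scope.


(** * Initial well-orders and transfinite selection *)

(** The order type is the cardinal of [T]: the last clause expresses, without cardinals, that every
    proper initial segment is smaller than [T]. *)
Lemma exists_initial_well_order (T : Type) :
  exists lt : T -> T -> Prop,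
    [/\ well_founded lt,
        forall x y, x <> y -> lt x y \/ lt y x &
        forall x (f : T -> T), injective f -> ~ forall t, lt (f t) x].
Proof.
have [r wo] := well_ordering_principle {classic T}.
pose lt (x y : T) := r x y /\ x <> y.
have least (A : set T) : A !=set0 -> exists2 x, A x & forall y, A y -> r x y.
  move=> [a Aa]; have [|x [[Ax lbx] _]] := wo (fun x => `[< A x >]).
    by exists a; apply/asboolP.
  by exists x => [|y Ay]; [exact/asboolP | apply: lbx; apply/asboolP].
have anti x y : r x y -> r y x -> x = y.
  move=> xy yx.
  have [|z [_ uz]] := wo (fun z => `[< z = x \/ z = y >]).
    by exists x; apply/asboolP; left.
  have rxx u : r u u.
    have [|v ->] := least [set u]; first by exists u.
    exact.
  transitivity z.
    apply/esym/uz; split; first by apply/asboolP; left.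
    by move=> w /asboolP[] ->.
  apply/uz; split; first by apply/asboolP; right.
  by move=> w /asboolP[] ->.
have wf : well_founded lt.
  move=> x; apply: contrapT => nx.
  have [|m nm lm] := least [set x | ~ Acc lt x]; first by exists x.
  apply: nm; constructor => y [ym yneq]; apply: contrapT => /lm my.
  exact/yneq/anti.
have tot x y : x <> y -> lt x y \/ lt y x.
  move=> xy; have [|z [] -> lz] := least [set x; y]; first by exists x; left.
    by left; split => //; apply: lz; right.
  by right; split; [apply: lz; left | move=> /esym].
(* If some initial segment has the size of T, the least such one is pulled
   back to T. *)
pose big x := exists2 f : T -> T, injective f & forall t, lt (f t) x.
have [|nbig] := pselect (exists x, big x); last first.
  by exists lt; split => // x f finj flt; apply: nbig; exists x, f.
move=> /least[m [g ginj gm] lm].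
exists (fun x y => lt (g x) (g y)); split.
- exact: Wellfounded.Inverse_Image.wf_inverse_image.
- by move=> x y xy; apply: tot => /ginj.
- move=> x f finj flt.
  have [rxm neq] := gm x.
  have rmx : r m (g x) by apply: lm; exists (g \o f) => //; exact: inj_comp.
  by apply: neq; exact: anti.
Qed.

(** Recursion along an initial well-order of [T], pulled back to [I] by [c]. At stage [i] fewer than
    [|T|] earlier points are to be avoided, and [pr] stands in for [|T| * |T| = |T|], so that [p i]
    and [q i] can avoid them with the same index. *)
Lemma exists_separated_selection (I T M : Type) (c : I -> T)
    (pr : T -> T -> T) (p q : I -> T -> M) :
  injective c ->
  (forall a a' b b', pr a b = pr a' b' -> a = a' /\ b = b') ->
  (forall i, injective (p i)) -> (forall i, injective (q i)) ->
  exists t : I -> T, forall i j, p i (t i) = q j (t j) -> i = j.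
Proof.
move=> cinj prinj pinj qinj.
have [lt [wf tot small]] := exists_initial_well_order T.
pose ltI i j := lt (c i) (c j).
have wfI : well_founded ltI by exact: Wellfounded.Inverse_Image.wf_inverse_image.
(* Choosing for each [s] some [j] below [i] that covers [phi s] would inject [T] into a proper
   initial segment. *)
have avoid i (phi : T -> M) (psi : forall j, ltI j i -> M) : injective phi ->
    ~ forall s, exists j (ji : ltI j i), phi s = psi j ji.
  move=> phiinj /choice[g /(_ _)/cid gP].
  apply: (small (c i) (c \o g)); last by move=> s; have [] := gP s.
  apply: inj_comp => // s s' gss'; apply: phiinj.
  have [si ->] := gP s; have [si' ->] := gP s'.
  by move: si si'; rewrite gss' => si si'; rewrite (Prop_irrelevance si si').
have step i (u : forall j, ltI j i -> T) : {s | forall j (ji : ltI j i),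
    p i s <> q j (u j ji) /\ q i s <> p j (u j ji)}.
  apply/cid; apply: contrapT => nos.
  (* T is the union of B and its complement: through the pairing [pr], either
     B contains a copy of T or its complement does. *)
  pose B s := exists j (ji : ltI j i), p i s = q j (u j ji).
  have [[a aB]|nB] := pselect (exists a, forall b, B (pr a b)).
    apply: (avoid i (p i \o pr a) (fun j ji => q j (u j ji))) => //.
    by move=> b b' /pinj/prinj[].
  have /choice[g gB] : forall a, exists b, ~ B (pr a b).
    by move=> a; apply/existsNP => aB; apply: nB; exists a.
  apply: (avoid i (fun a => q i (pr a (g a))) (fun j ji => p j (u j ji))).
    by move=> a a' /qinj/prinj[].
  move=> a; apply: contrapT => na; apply: nos; exists (pr a (g a)) => j ji.
  by split=> e; [apply: (gB a) | apply: na]; exists j; exists ji.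
pose F i (u : forall j, ltI j i -> T) := sval (step i u).
pose t := Fix wfI (fun=> T) F.
have tE i : t i = F i (fun j _ => t j).
  apply: (Fix_eq wfI (fun=> T) F) => x f g fg.
  suff -> : f = g by [].
  apply: functional_extensionality_dep => y.
  apply: functional_extensionality_dep => yx; exact: fg.
have tP i j : ltI j i -> p i (t i) <> q j (t j) /\ q i (t i) <> p j (t j).
  by move=> ji; rewrite (tE i); exact: (svalP (step i (fun j _ => t j)) j ji).
exists t => i j e; apply: contrapT => ij.
have /tot[/tP[_]|/tP[+ _]] : c i <> c j by move=> /cinj.
  by apply; exact/esym.
exact.
Qed.


(** * Condensation points, relative Baire category and F_sigma sets *)

Definition countable_base (T : topologicalType) (V : nat -> set T) :=
  (forall k, open (V k)) /\
  (forall x U, open U -> U x -> exists2 k, V k x & V k `<=` U).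

Definition condensation (T : topologicalType) : set T :=
  [set x | forall U, open U -> U x -> ~ countable U].

(* Density is relative to C, while D itself is open in the whole space. *)
Definition dense_open_in (T : topologicalType) (C D : set T) :=
  open D /\ forall U, open U -> U `&` C !=set0 -> U `&` D `&` C !=set0.

Definition comeager_part (T : topologicalType) (C : set T)
  (D : nat -> set T) : set T := C `&` \bigcap_n D n.

Lemma homeomorphic_separable (X Y : topologicalType) :
  homeomorphic X Y -> separable_space X -> separable_space Y.
Proof.
move=> [h [g [hK gK hc gc]]] [D cD dD]; exists (h @` D).
  exact: (sub_countable (card_image_le _ _)).
move=> O [y Oy] oO; have [||x [Ox Dx]] := dD (h @^-1` O).
- by exists (g y); rewrite /preimage /= gK.
- by apply: open_comp => // x _; exact: hc.
- by exists (h x); split => //; exists x.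
Qed.

Lemma separable_countable_base (R : realType) (M : metricType R) :
  separable_space M -> exists V : nat -> set M, countable_base M V.
Proof.
move=> [D /countable_injP[i iinj] dD].
(* As [i] is injective on [D], the union has at most one term: it is the open ball kernel around the
   point of code [n], or empty if there is none. *)
exists (fun z => if unpickle z is Some (n, m) then
  \bigcup_(d in [set d | D d /\ i d = n]) (ball d (m.+1%:R^-1 : R))° else set0).
split=> [k|x U oU Ux].
  case: unpickle => [[n m]|]; last exact: open0.
  by apply: bigcup_open => d _; exact: open_interior.
have /nbhs_ballP[e /= e0 eU] : nbhs x U by exact: open_nbhs_nbhs.
have e20 : (0 < e / 2)%R by rewrite divr_gt0.
have [m _ /(_ m (leqnn m)) /= me] := near_infty_natSinv_lt (PosNum e20).
set d := (m.+1%:R^-1 : R)%R in me.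
have d0 : (0 < d)%R by rewrite invr_gt0.
have d20 : (0 < d / 2)%R by rewrite divr_gt0.
have [||y [yx Dy]] := dD (ball x (d / 2))°.
- by exists x; apply: nbhsx_ballx.
- exact: open_interior.
exists (pickle (i y, m)); rewrite pickleK.
  exists y => //; rewrite -/d; apply/nbhs_ballP; exists (d / 2)%R => //= z xz.
  rewrite (splitr d); apply: ball_triangle xz.
  by apply: ball_sym; exact: interior_subset yx.
move=> z [y' [Dy' /iinj]]; rewrite !inE => /(_ Dy' Dy) -> yz.
apply: eU; have := ball_triangle (interior_subset yx) (interior_subset yz).
apply: le_ball; rewrite (splitr e) lerD// ?(ltW me)//.
by rewrite (le_trans _ (ltW me))// ler_pdivrMr// ler_peMr ?(ltW d0)// ler1n.
Qed.

Lemma base_separates (T : topologicalType) (V : nat -> set T) (x y : T) :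
  hausdorff_space T -> countable_base T V -> x <> y ->
  exists k l, [/\ V k x, V l y & V k `&` V l = set0].
Proof.
rewrite open_hausdorff => hT [_ Vb] /eqP/hT[[A B]] /=.
move=> [/set_mem Ax /set_mem By] [oA oB /eqP AB].
have [k Vkx kA] := Vb x A oA Ax; have [l Vly lB] := Vb y B oB By.
exists k, l; split => //; rewrite -subset0 => z [/kA Az /lB Bz].
by rewrite -[set0]AB.
Qed.

Lemma base_ext (T : topologicalType) (V : nat -> set T) (x y : T) :
  hausdorff_space T -> countable_base T V ->
  (forall k, V k x <-> V k y) -> x = y.
Proof.
move=> hT Vb xy; apply: contrapT => /(base_separates _ _ _ _ hT Vb).
move=> [k [l [Vkx Vly Vkl]]].
have : (V k `&` V l) y by split => //; exact/xy.
by rewrite Vkl.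
Qed.

(** Otherwise [U] would be covered by [x] and the countable basic sets, of which there are only
    countably many. *)
Lemma condensation_exists (T : topologicalType) (V : nat -> set T)
    (U : set T) (x : T) :
  countable_base T V -> open U -> ~ countable U ->
  exists y, [/\ y <> x, U y & condensation T y].
Proof.
move=> [oV Vb] oU nU; apply: contrapT => noy; apply: nU.
pose F (k : option nat) : set T :=
  if k is Some k then [set y | V k y /\ countable (V k)] else [set x].
apply: (@sub_countable _ _ _ (\bigcup_k F k)); last first.
  apply: bigcup_countable => [|[k|] _]; first exact: countableP.
    have [cV|ncV] := pselect (countable (V k)).
      by apply: sub_countable cV; apply: subset_card_le => y [].
    by rewrite [F _](_ : _ = set0)//= -subset0 => y [].
  exact: countable1.
apply: subset_card_le => y Uy.
have [->|yx] := pselect (y = x); first by exists None.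
have : ~ condensation T y by move=> cy; apply: noy; exists y.
move=> /existsNP[W /not_implyP[oW /not_implyP[Wy /contrapT cW]]].
have [k Vky kW] := Vb y W oW Wy.
exists (Some k) => //; split => //.
by apply: sub_countable cW; exact: subset_card_le.
Qed.

Lemma closed_condensation (T : topologicalType) : closed (condensation T).
Proof.
move=> x clx U oU Ux; have [|y [cy Uy]] := clx U; first exact: open_nbhs_nbhs.
exact: cy.
Qed.

Lemma dense_open_inT (T : topologicalType) (C : set T) :
  dense_open_in T C setT.
Proof. by split => [|U oU]; [exact: openT | rewrite setIT]. Qed.

(** The Baire property relative to [C]: the sets that agree with an open set on a comeager part form
    a sigma-algebra. For complements, [O] is replaced by its exterior [O'], and the dense open set
    formed by [O] and [O'] joins the sequence. *)
Lemma borel_open_on_comeager (T : topologicalType) (C B : set T) :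
  borel_set B -> exists (D : nat -> set T) (O : set T),
    [/\ forall n, dense_open_in T C (D n), open O &
        forall x, comeager_part T C D x -> (B x <-> O x)].
Proof.
move: B; apply: smallest_sub; last first.
  move=> B oB; exists (fun=> setT), B; split => // n; exact: dense_open_inT.
split.
- exists (fun=> setT), set0; split => //; last exact: open0.
  by move=> n; exact: dense_open_inT.
- move=> B [D [ O [dD oO BO]]].
  (* the exterior of O relative to C *)
  pose O' := \bigcup_(U in [set U | open U /\ U `&` O `&` C = set0]) U.
  have oO' : open O' by apply: bigcup_open => U [].
  exists (fun n => if n is n.+1 then D n else O `|` O'), O'; split => //.
    case=> // ; split=> [|U oU UC]; first exact: openU.
    have [UO|] := eqVneq (U `&` O `&` C) set0.
      have [x [Ux Cx]] := UC; exists x; split => //; split => //; right.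
      by exists U.
    by move=> /set0P[x [[Ux Ox] Cx]]; exists x; split => //; split => //; left.
  move=> x [Cx Dx]; have BOx : B x <-> O x.
    by apply: BO; split => // n _; exact: (Dx n.+1).
  split=> [[_ nB]|[U [oU UO] Ux]].
    by have [/BOx//|] := Dx 0 I.
  split => // /BOx Ox; have : (U `&` O `&` C) x by [].
  by rewrite UO.
- move=> B /choice[D /choice[ O DO]].
  exists (fun z => if unpickle z is Some (i, n) then D i n else setT).
  exists (\bigcup_k O k); split.
  + move=> z; case: unpickle => [[i n]|]; last exact: dense_open_inT.
    by have [] := DO i.
  + by apply: bigcup_open => i _; have [] := DO i.
  + move=> x [Cx Dx].
    have BOx i : B i x <-> O i x.
      have [_ _] := DO i; apply; split => // n _.
      by have := Dx (pickle (i, n)) I; rewrite pickleK.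
    by split=> -[i _ /BOx ?]; exists i.
Qed.

Lemma Bor_continuous_on_comeager (T : topologicalType) (C : set T)
    (V : nat -> set T) (f : T -> T) :
  (forall k, open (V k)) -> Bor f ->
  exists D O : nat -> set T,
    [/\ forall n, dense_open_in T C (D n), forall k, open (O k) &
        forall x k, comeager_part T C D x -> (V k (f x) <-> O k x)].
Proof.
move=> oV bf.
have /choice[D /choice[ O DO]] : forall k, exists D O,
    [/\ forall n, dense_open_in T C (D n), open O &
        forall x, comeager_part T C D x -> (V k (f x) <-> O x)].
  move=> k; apply: (borel_open_on_comeager T C (f @^-1` V k)).
  by apply: bf; apply: sub_sigma_algebra; exact: oV.
exists (fun z => if unpickle z is Some (i, n) then D i n else setT), O; split.
- move=> z; case: unpickle => [[i n]|]; last exact: dense_open_inT.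
  by have [] := DO i.
- by move=> k; have [] := DO k.
- move=> x k [Cx Dx]; have [_ _] := DO k; apply; split => // n _.
  by have := Dx (pickle (k, n)) I; rewrite pickleK.
Qed.

(** By regularity, [U] is the union of the closures of basic sets that it contains. *)
Lemma open_Fsigma (T : topologicalType) (V : nat -> set T) (U : set T) :
  regular_space T -> countable_base T V -> open U -> Fsigma U.
Proof.
move=> rT [oV Vb] oU.
exists (fun k => if `[< closure (V k) `<=` U >] then closure (V k) else set0).
  by move=> k; case: ifP => _; [exact: closed_closure | exact: closed0].
apply/seteqP; split=> x; last by move=> [k _]; case: asboolP => // kU /kU.
move=> Ux; have [|B Bx BU] := rT x U; first exact: open_nbhs_nbhs.
have [k Vkx kB] := Vb x B° (open_interior B) Bx.
exists k => //; case: asboolP => [_|[]]; first exact: subset_closure.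
apply: subset_trans BU; apply: closure_subset.
exact: subset_trans kB (@interior_subset _ _).
Qed.

(** The preimage of [A] is [A] intersected with the F_sigma set [U], together with the closed
    complement of [U] when [y] is in [A]. *)
Lemma D2_piecewise_id_cst (T : topologicalType) (V : nat -> set T)
    (U : set T) (y : T) :
  regular_space T -> countable_base T V -> open U ->
  D2 (fun x => if x \in U then x else y).
Proof.
move=> rT Vb oU A [F cF AF].
have [K cK UK] := open_Fsigma T V U rT Vb oU.
pose E : set T := if y \in A then ~` U else set0.
have cE : closed E.
  by rewrite /E; case: ifP => _; [exact: open_closedC | exact: closed0].
exists (fun z => match unpickle z : option (option (nat * nat)) with
  | Some (Some (n, m)) => F n `&` K m | Some None => E | None => set0 end).
  move=> z; case: unpickle => [[[n m]|]|] //; first exact: closedI.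
  exact: closed0.
apply/seteqP; split=> x; rewrite /preimage /mkset.
  have [/set_mem Ux|/negP nU] := boolP (x \in U).
    rewrite AF => -[n _ Fx]; move: Ux; rewrite UK => -[m _ Kx].
    by exists (pickle (Some (n, m) : option (nat * nat))) => //; rewrite pickleK.
  move=> Ay; exists (pickle (None : option (nat * nat))) => //.
  by rewrite pickleK /E mem_set// => Ux; apply: nU; rewrite inE.
move=> [z _]; case: unpickle => [[[n m]|]|] //.
  move=> [Fx Kx]; rewrite mem_set; last by rewrite UK; exists m.
  by rewrite AF; exists n.
rewrite /E; case: ifPn => // /set_mem Ay nUx.
by rewrite memNset.
Qed.


(** * Cantor schemes and disjoint open sets *)

(** Points picked in [N n] and [C] form a Cauchy sequence; its limit lies in the closure of
    [N n.+1], hence in [N n]. *)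
Lemma nested_intersection_nonempty (R : realType) (M : metricType R)
    (C : set M) (N : nat -> set M) :
  complete_metric M -> closed C ->
  (forall n, N n `&` C !=set0) ->
  (forall n, closure (N n.+1) `<=` N n) ->
  (forall n, exists c : M, N n.+1 `<=` ball c (n.+1%:R^-1 : R)) ->
  exists x, C x /\ forall n, N n x.
Proof.
move=> cM cC /choice[u uP] Ncl Nball.
have Nmono n m : n <= m -> N m `<=` N n.
  elim: m => [|m IH]; first by rewrite leqn0 => /eqP ->.
  rewrite leq_eqVlt => /orP[/eqP -> //|]; rewrite ltnS => /IH nm.
  apply: subset_trans nm; apply: subset_trans (Ncl m); exact: subset_closure.
have uN n : \forall m \near \oo, N n (u m).
  by exists n => // m /= nm; apply: Nmono nm _ _; have [] := uP m.
have cu : cauchy (u @ \oo).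
  apply: cauchy_exP => e e0.
  have [n _ /(_ n (leqnn n)) /= ne] := near_infty_natSinv_lt (PosNum e0).
  have [c Nc] := Nball n; exists c.
  apply: filterS (uN n.+1) => m Num.
  by apply: (le_ball (ltW ne)); exact: Nc.
have [x ux] := cM u cu; exists x; split.
  apply: (closed_cvg C cC _ _ ux).
  by apply: nearW => n; have [] := uP n.
move=> n; apply: Ncl.
apply: (closed_cvg (closure (N n.+1)) (@closed_closure _ _) _ _ ux).
by apply: filterS (uN n.+1) => m; exact: subset_closure.
Qed.

Lemma shrink_open_in (R : realType) (M : metricType R) (C D U : set M)
    (e : R) :
  (0 < e)%R -> dense_open_in M C D -> open U -> U `&` C !=set0 ->
  exists V, [/\ open V, V `&` C !=set0, closure V `<=` U `&` D &
                exists c : M, V `<=` ball c e].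
Proof.
move=> e0 [oD dD] oU /(dD _ oU)[x [UDx Cx]].
have UDn : nbhs x (U `&` D) by apply: open_nbhs_nbhs; split => //; exact: openI.
have [B Bx BU] := @uniform_regular M x _ UDn.
exists (B `&` ball x e)°; split.
- exact: open_interior.
- by exists x; split => //; apply: filterI => //; exact: nbhsx_ballx.
- apply: subset_trans BU; apply: closure_subset => z /interior_subset[].
  by [].
- by exists x => z /interior_subset[].
Qed.

(** A binary tree of open sets meeting [C]: the children of a node of level [n] have closures inside
    it and inside [D n], lie in balls of vanishing radius, and are [Q]-related on the comeager part.
    Each branch converges to a point. *)
Lemma cantor_scheme (R : realType) (M : metricType R) (C U0 : set M)
    (D : nat -> set M) (Q : M -> M -> Prop) :
  complete_metric M -> closed C -> (forall n, dense_open_in M C (D n)) ->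
  open U0 -> U0 `&` C !=set0 ->
  (forall x y, Q x y -> Q y x) ->
  (forall U, open U -> U `<=` U0 -> U `&` C !=set0 ->
     exists V W, [/\ open V /\ open W, V `&` U `&` C !=set0,
       W `&` U `&` C !=set0 &
       forall x y, V x -> W y -> comeager_part M C D x ->
         comeager_part M C D y -> Q x y]) ->
  exists e : (nat -> bool) -> M,
    (forall s, U0 (e s) /\ comeager_part M C D (e s)) /\
    (forall s t, s <> t -> Q (e s) (e t)).
Proof.
move=> cM cC dD oU0 U0C Qsym split_open.
pose S := {U : set M | [/\ open U, U `<=` U0 & U `&` C !=set0]}.
have step (nU : nat * S) : exists N : bool -> S,
    (forall b, closure (sval (N b)) `<=` sval nU.2 `&` D nU.1 /\
       exists c : M, sval (N b) `<=` ball c (nU.1.+1%:R^-1 : R)) /\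
    (forall x y, sval (N true) x -> sval (N false) y -> comeager_part M C D x ->
         comeager_part M C D y -> Q x y).
  case: nU => n [U [oU UU0 UC]] /=.
  have [V [W [[oV oW] VC WC VWQ]]] := split_open U oU UU0 UC.
  have n0 : (0 < n.+1%:R^-1 :> R)%R by rewrite invr_gt0.
  have mk A : open A -> A `&` U `&` C !=set0 -> exists A' : S,
      [/\ closure (sval A') `<=` U `&` D n, sval A' `<=` A &
       exists c : M, sval A' `<=` ball c (n.+1%:R^-1 : R)].
    move=> oA AUC.
    have [A' [oA' A'C A'U A'b]] := shrink_open_in R M C (D n) (A `&` U) _ n0
      (dD n) (openI oA oU) AUC.
    have A'sub : A' `<=` A `&` U.
      by move=> z /subset_closure/A'U[].
    have A'S : [/\ open A', A' `<=` U0 & A' `&` C !=set0].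
      by split => // z /A'sub[_ /UU0].
    exists (exist _ A' A'S); split => //=.
      by move=> z /A'U[[]].
    by move=> z /A'sub[].
  have [V' [V'U V'V V'b]] := mk V oV VC.
  have [W' [W'U W'W W'b]] := mk W oW WC.
  exists (fun b => if b then V' else W'); split; first by case.
  by move=> x y /V'V Vx /W'W Wy; exact: VWQ.
have {step}[N NP] := choice step.
have U0S : [/\ open U0, U0 `<=` U0 & U0 `&` C !=set0] by split.
pose K (s : nat -> bool) := fix K n : S :=
  if n is m.+1 then N (m, K m) (s m) else exist _ U0 U0S.
have KS s n : K s n.+1 = N (n, K s n) (s n) by [].
have /choice[e eP] : forall s, exists x, C x /\ forall n, sval (K s n) x.
  move=> s; apply: nested_intersection_nonempty => // n.
  - by case: (K s n) => U [].
  - by rewrite KS => z; have [/(_ (s n))[+ _] _] := NP (n, K s n) => /[apply] -[].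
  - by rewrite KS; have [/(_ (s n))[_ +] _] := NP (n, K s n).
have eD s : comeager_part M C D (e s).
  have [Ce Ke] := eP s; split => // n _.
  have := Ke n.+1; rewrite KS => /subset_closure.
  by have [/(_ (s n))[+ _] _] := NP (n, K s n) => /[apply] -[].
exists e; split=> [s|s t st].
  by split => //; have [_ /(_ 0)] := eP s.
have ex : exists n, s n != t n.
  apply: contrapT => nst; apply: st; apply/funext => n.
  by apply/eqP; apply: contrapT => /negP stn; apply: nst; exists n.
(* Up to the first difference [n] both branches share the node [K s n]; they then enter different
   children of it. *)
case: (ex_minnP ex) => n stn nmin.
have KE : K s n = K t n.
  have : forall m, m <= n -> K s m = K t m.
    elim=> // m IH mn; rewrite !KS IH ?(ltnW mn)//; congr (N _ _).
    by apply/eqP; apply: contraTT mn => /nmin; rewrite -leqNgt.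
  exact.
have [_ NQ] := NP (n, K s n).
have [_ /(_ n.+1)] := eP s; have [_ /(_ n.+1)] := eP t; rewrite !KS -KE.
case: (s n) (t n) stn => [] [] // _ Kt Ks; last apply: Qsym; exact: NQ.
Qed.

Definition scons (b : bool) (t : nat -> bool) : nat -> bool :=
  fun n => if n is m.+1 then t m else b.

Lemma scons_inj b b' t t' : scons b t = scons b' t' -> b = b' /\ t = t'.
Proof.
move=> e; split; first exact: (congr1 (@^~ 0) e).
by apply/funext => n; exact: (congr1 (@^~ n.+1) e).
Qed.

(** If every open set inside [U0] meeting [C] splits into parts with different values of [f], a
    scheme makes [f \o p] injective. Otherwise [f] is constant on the points of [G] in some open
    [U], and a scheme inside [U] yields both families. *)
Lemma injective_or_constant_family (R : realType) (M : metricType R)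
    (V D O : nat -> set M) (U0 : set M) (f : M -> M) :
  complete_metric M -> countable_base M V ->
  (forall n, dense_open_in M (condensation M) (D n)) ->
  (forall k, open (O k)) ->
  (forall x k, comeager_part M (condensation M) D x -> (V k (f x) <-> O k x)) ->
  open U0 -> U0 `&` condensation M !=set0 ->
  exists p q : (nat -> bool) -> M,
    [/\ injective p, injective q,
        forall t, U0 (p t) /\ comeager_part M (condensation M) D (p t) &
        (forall t, q t = f (p t)) \/
        (forall t, [/\ U0 (q t), comeager_part M (condensation M) D (q t),
                      q t <> p t & f (q t) = f (p t)])].
Proof.
move=> cM Vb dD oO fO oU0 U0C.
have hM : hausdorff_space M by exact: metric_hausdorff.
set C := condensation M in dD fO U0C *.
set G := comeager_part M C D in fO *.
have cC : closed C by exact: closed_condensation.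
pose splits (P : M -> M -> Prop) U := exists V W, [/\ open V /\ open W,
  V `&` U `&` C !=set0, W `&` U `&` C !=set0 &
  forall x y, V x -> W y -> G x -> G y -> P x y].
have splitN x y U : open U -> U x -> U y -> C x -> C y -> x <> y ->
    splits (fun x y => x <> y) U.
  move=> oU Ux Uy Cx Cy /(base_separates _ _ _ _ hM Vb)[k [l [Vkx Vly kl]]].
  exists (V k), (V l); split; first by split; apply Vb.
  - by exists x.
  - by exists y.
  - move=> z w Vz Vw _ _ zw; have : (V k `&` V l) z by split => //; rewrite zw.
    by rewrite kl.
have [fsplit|] := pselect (forall U, open U -> U `<=` U0 -> U `&` C !=set0 ->
    splits (fun x y => f x <> f y) U).
  have [||e [eP einj]] :=
    cantor_scheme R M C U0 D (fun x y => f x <> f y) cM cC dD oU0 U0C.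
  - by move=> x y xy /esym.
  - exact: fsplit.
  have finj : injective (f \o e).
    by move=> s t /= st; apply: contrapT => /einj.
  exists e, (f \o e); split => //; last by left.
  exact: inj_compr finj.
move=> /existsNP[U /not_implyP[oU /not_implyP[UU0 /not_implyP[UC nsplit]]]].
(* Disjoint basic neighbourhoods of two values would make [O k] and [O l] split [U]. *)
have fcst x y : U x -> U y -> G x -> G y -> f x = f y.
  move=> Ux Uy Gx Gy; apply: contrapT.
  move=> /(base_separates _ _ _ _ hM Vb)[k [l [Vkx Vly kl]]].
  apply: nsplit; exists (O k), (O l); split => //.
  - by exists x; split; [split => //; exact/fO | case: Gx].
  - by exists y; split; [split => //; exact/fO | case: Gy].
  - move=> z w Oz Ow Gz Gw zw.
    have : (V k `&` V l) (f z) by split; [exact/fO | rewrite zw; exact/fO].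
    by rewrite kl.
have [||e [eP einj]] :=
  cantor_scheme R M C U D (fun x y => x <> y) cM cC dD oU UC.
- by move=> x y xy /esym.
- move=> W oW _ [x [Wx Cx]].
  have [y [yx Wy Cy]] := condensation_exists M V W x Vb oW (Cx W oW Wx).
  exact: (splitN y x).
have einj' : injective e by move=> s t st; apply: contrapT => /einj.
(* The first bit cuts one injective family into two with disjoint ranges. *)
exists (e \o scons true), (e \o scons false); split.
- by move=> s t /einj'/scons_inj[].
- by move=> s t /einj'/scons_inj[].
- by move=> t; have [/UU0] := eP (scons true t).
- right=> t; have [Ut Gt] := eP (scons true t).
  have [Uf Gf] := eP (scons false t); split => //.
  + exact: UU0.
  + by move=> /einj'/scons_inj[].
  + exact: fcst.
Qed.

(** Two condensation points of the current open set are separated; the neighbourhood of one is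
    output, that of the other is kept for the next step. *)
Lemma disjoint_open_sequence (T : topologicalType) (V : nat -> set T) :
  hausdorff_space T -> countable_base T V -> ~ countable [set: T] ->
  exists U : nat -> set T,
    [/\ forall n, open (U n), forall n, U n `&` condensation T !=set0 &
        forall n m x, U n x -> U m x -> n = m].
Proof.
move=> hT Vb nT.
pose S := {U : set T | open U /\ U `&` condensation T !=set0}.
have step (W : S) : exists A : set T * S,
   [/\ open A.1, A.1 `&` condensation T !=set0, A.1 `<=` sval W,
       sval A.2 `<=` sval W & A.1 `&` sval A.2 = set0].
  case: W => W [oW [x [Wx Cx]]] /=.
  have [y [yx Wy Cy]] := condensation_exists T V W x Vb oW (Cx W oW Wx).
  have [k [l [Vky Vlx kl]]] := base_separates _ _ _ _ hT Vb yx.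
  have oV i : open (W `&` V i) by apply: openI => //; apply Vb.
  have lS : open (W `&` V l) /\ W `&` V l `&` condensation T !=set0.
    by split => //; exists x.
  pose A : S := exist _ (W `&` V l) lS.
  exists (W `&` V k, A); split => //=.
  - by exists y.
  - by rewrite setIACA kl setI0.
have [F FP] := choice step.
have TS : open [set: T] /\ [set: T] `&` condensation T !=set0.
  split; first exact: openT.
  have [x0 _] : [set: T] !=set0.
    by apply/set0P/eqP => T0; apply: nT; rewrite T0; exact: countable0.
  have [x [_ _ Cx]] := condensation_exists T V setT x0 Vb openT nT.
  by exists x.
pose W := fix W n : S := if n is m.+1 then (F (W m)).2 else exist _ setT TS.
have Wmono n m : n <= m -> sval (W m) `<=` sval (W n).
  elim: m => [|m IH]; first by rewrite leqn0 => /eqP ->.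
  rewrite leq_eqVlt => /orP[/eqP -> //|]; rewrite ltnS => /IH nm.
  by apply: subset_trans nm; have [] := FP (W m).
pose U n := (F (W n)).1.
have Udisj n m x : n < m -> U n x -> U m x -> False.
  move=> nm Unx Umx; have [_ _ _ _ nW] := FP (W n).
  have : ((F (W n)).1 `&` sval (F (W n)).2) x.
    split => //; apply: (Wmono n.+1 m nm).
    by have [_ _ + _ _] := FP (W m); apply.
  by rewrite nW.
exists U; split.
- by move=> n; have [] := FP (W n).
- by move=> n; have [] := FP (W n).
- move=> n m x Unx Umx; have [nm|mn|//] := ltngtP n m.
    by case: (Udisj n m x).
  by case: (Udisj m n x).
Qed.


(** * Coding by points of Cantor space and construction of [psi] *)

Definition spread (K : countType) (g : K -> bool) : nat -> bool :=
  fun n => if unpickle n is Some k then g k else false.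

Lemma spread_inj (K : countType) : injective (@spread K).
Proof.
move=> g g' e; apply/funext => k.
by have := congr1 (@^~ (pickle k)) e; rewrite /spread pickleK.
Qed.

Definition union_of (T : Type) (V : nat -> set T) (c : nat -> bool) : set T :=
  \bigcup_(j in [set j | c j]) V j.

Lemma open_union_of (T : topologicalType) (V : nat -> set T) (U : set T) :
  countable_base T V -> open U -> exists c, U = union_of T V c.
Proof.
move=> [_ Vb] oU; exists (fun j => `[< V j `<=` U >]).
apply/seteqP; split=> x; last by move=> [j /asboolP]; apply.
by move=> /(Vb x U oU)[j Vjx jU]; exists j => //; exact/asboolP.
Qed.

Lemma reducibility_embedding_metric (R : realType) (M : metricType R) :
  complete_metric M -> separable_space M -> ~ countable [set: M] ->
  exists psi : set nat -> set M,
    forall a b : set nat,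
      (a `<=` b -> reducible (@D2 M) (psi a) (psi b)) /\
      (reducible (@Bor M) (psi a) (psi b) -> a `<=` b).
Proof.
move=> cM sM nM; have hM : hausdorff_space M by exact: metric_hausdorff.
have [V Vb] := separable_countable_base R M sM.
have [U [oU UC Udisj]] := disjoint_open_sequence M V hM Vb nM.
set C := condensation M in UC.
(* A code (n, d, w) stands for the open set U n.+1, the dense open sets
   union_of (d m), and the partial function sending x to the point y such that
   V k contains y iff union_of (w k) contains x. *)
pose valid (i : nat * (nat -> nat -> bool) * (nat -> nat -> bool))
    (pq : ((nat -> bool) -> M) * ((nat -> bool) -> M)) :=
  let G := comeager_part M C (fun n => union_of M V (i.1.2 n)) in
  let O k := union_of M V (i.2 k) in
  [/\ injective pq.1, injective pq.2,
      forall t, U i.1.1.+1 (pq.1 t) /\ G (pq.1 t) &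
      (forall t k, V k (pq.2 t) <-> O k (pq.1 t)) \/
      (forall t, [/\ U i.1.1.+1 (pq.2 t), G (pq.2 t), pq.2 t <> pq.1 t &
                    forall k, O k (pq.2 t) <-> O k (pq.1 t)])].
(* [valid] refers to codes only, not to a Borel map, so [I] injects into Cantor space. *)
pose I := {i | exists pq, valid i pq}.
have /choice[pq pqP] : forall i : I, exists pq, valid (sval i) pq by case.
pose code (i : I) : nat -> bool :=
  @spread (nat + (nat * nat) + (nat * nat))%type (fun k => match k with
    | inl (inl n) => n == (sval i).1.1
    | inl (inr (n, j)) => (sval i).1.2 n j
    | inr (n, j) => (sval i).2 n j end).
have code_inj : injective code.
  move=> [[[n d] o] iv] [[[n' d'] o'] iv'] /spread_inj /= e.
  apply: eq_exist => /=; congr (_, _, _).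
  - by have := congr1 (@^~ (inl (inl n))) e; rewrite /= eqxx => /esym/eqP.
  - by apply/funext => m; apply/funext => j;
      exact: (congr1 (@^~ (inl (inr (m, j)))) e).
  - by apply/funext => m; apply/funext => j;
      exact: (congr1 (@^~ (inr (m, j))) e).
pose pr (a b : nat -> bool) : nat -> bool :=
  @spread (nat + nat)%type (fun k => match k with inl m => a m | inr m => b m end).
have pr_inj a a' b b' : pr a b = pr a' b' -> a = a' /\ b = b'.
  move=> /spread_inj e; split; apply/funext => m.
    exact: (congr1 (@^~ (inl m)) e).
  exact: (congr1 (@^~ (inr m)) e).
have [||t tP] := exists_separated_selection I (nat -> bool) M code pr
    (fun i => (pq i).1) (fun i => (pq i).2) code_inj pr_inj.
- by move=> i; have [] := pqP i.
- by move=> i; have [] := pqP i.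
pose Y := [set x | exists i, x = (pq i).1 (t i)].
(* By the selection, a [q]-point can only be in [Y] as the [p]-point of the same index. *)
have Yq i : Y ((pq i).2 (t i)) -> (pq i).2 (t i) = (pq i).1 (t i).
  by move=> [j qE]; rewrite qE (tP j i (esym qE)).
pose Ua (a : set nat) := \bigcup_(n in a) U n.+1.
exists (fun a => Y `&` Ua a) => a b; split.
  (* [U 0] is disjoint from every [Ua b], so [y0] lies in no value of [psi]. *)
  move=> ab; have [y0 [Uy0 _]] := UC 0.
  exists (fun x => if x \in Ua a then x else y0).
    apply: (D2_piecewise_id_cst M V) => //; first exact: uniform_regular.
    by apply: bigcup_open => n _.
  apply/seteqP; split=> x; rewrite /preimage /mkset.
    move=> [Yx Uax]; rewrite mem_set//; split => //.
    by have [n an Ux] := Uax; exists n => //; exact: ab.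
  have [/set_mem Uax [Yx _] //|_ [_ [n _ Uny0]]] := boolP (x \in Ua a).
  by have := Udisj _ _ _ Uy0 Uny0.
move=> [f bf abE] n an; apply: contrapT => nbn.
have [D [ O [dD oO fO]]] := Bor_continuous_on_comeager M C V f Vb.1 bf.
have /choice[d dE] : forall m, exists c, D m = union_of M V c.
  by move=> m; apply: open_union_of => //; have [] := dD m.
have /choice[w oE] : forall k, exists c, O k = union_of M V c.
  by move=> k; exact: open_union_of.
have DE : (fun n => union_of M V (d n)) = D by apply/funext => m.
(* The code of [f] and [n] is an index, so points were selected for it. *)
have iv : exists pq, valid (n, d, w) pq.
  have [p [q [pinj qinj pP pqP']]] := injective_or_constant_family R M V D O
    (U n.+1) f cM Vb dD oO fO (oU _) (UC _).
  exists (p, q); split => //=; first by rewrite DE.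
  case: pqP' => [qf|qf]; [left|right] => s.
    by move=> k; rewrite qf -oE; apply: fO; have [] := pP s.
  have [Uq Gq qp fqp] := qf s; rewrite DE; split => // k.
  by rewrite -oE -!fO ?fqp//; have [] := pP s.
have [/= _ _] := pqP (exist _ (n, d, w) iv); rewrite DE.
set i := exist _ _ _ => /(_ (t i))[Up Gp] pqi.
have Ap : (Y `&` Ua a) ((pq i).1 (t i)) by split; [exists i | exists n].
have : (Y `&` Ua b) (f ((pq i).1 (t i))) by move: Ap; rewrite abE.
move=> [Yf [m bm Umf]].
have nm : n.+1 <> m.+1 by move=> [nm]; apply: nbn; rewrite nm.
case: pqi => [|] /(_ (t i)).
  (* Here [f] sends the [p]-point to the [q]-point, which is in [Y] and so equals the [p]-point; it
     would lie in both [U n.+1] and [U m.+1]. *)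
  move=> qV; have fq : f ((pq i).1 (t i)) = (pq i).2 (t i).
    by apply: (base_ext M V _ _ hM Vb) => k; rewrite qV -oE; exact: fO.
  move: Yf; rewrite fq => /Yq qp.
  by apply: nm; apply: Udisj Up _; rewrite -qp -fq.
(* Here both points have the same image, so the [q]-point is also in [psi a], hence in [Y], and must
   equal the [p]-point. *)
move=> [Uq Gq qp qO].
have fq : f ((pq i).1 (t i)) = f ((pq i).2 (t i)).
  apply: (base_ext M V _ _ hM Vb) => k.
  by rewrite !fO// oE; symmetry; exact: qO.
suff : (Y `&` Ua a) ((pq i).2 (t i)) by move=> [/Yq].
by rewrite abE /preimage /mkset -fq; split => //; exists m.
Qed.

(** * Transfer to Polish spaces and to the hierarchy *)

Lemma continuous_Fsigma (X Y : topologicalType) (h : X -> Y) (A : set Y) :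
  continuous h -> Fsigma A -> Fsigma (h @^-1` A).
Proof.
move=> hc [F cF ->]; exists (fun n => h @^-1` F n).
  by move=> n; apply: closed_comp => // x _; exact: hc.
by rewrite preimage_bigcup.
Qed.

Lemma continuous_borel_set (X Y : topologicalType) (h : X -> Y) (B : set Y) :
  continuous h -> borel_set B -> borel_set (h @^-1` B).
Proof.
move=> hc; move: B.
have [b0 bC bU] := smallest_sigma_algebra [set: X] [set U : set X | open U].
apply: smallest_sub.
  split.
  - exact: b0.
  - by move=> A bA; exact: (bC _ bA).
  - by move=> A bA; rewrite /= preimage_bigcup; exact: bU.
move=> U oU; apply: sub_sigma_algebra.
by apply: open_comp => // x _; exact: hc.
Qed.

(** [psi] is pulled back along the homeomorphism, and reductions are conjugated by it. *)
Lemma reducibility_embedding (R : realType) (X : topologicalType) :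
  polish_space R X -> ~ countable [set: X] ->
  exists psi : set nat -> set X,
    forall a b : set nat,
      (a `<=` b -> reducible (@D2 X) (psi a) (psi b)) /\
      (reducible (@Bor X) (psi a) (psi b) -> a `<=` b).
Proof.
move=> [sX [M [cM hXM]]] nX.
have sM := homeomorphic_separable X M hXM sX.
have [h [g [hK gK hc gc]]] := hXM.
have nM : ~ countable [set: M].
  move=> /countable_injP[i iinj]; apply: nX; apply/countable_injP.
  by exists (i \o h) => x y _ _ /iinj; rewrite !inE => /(_ I I)/(can_inj hK).
have [psi psiP] := reducibility_embedding_metric R M cM sM nM.
exists (fun a => h @^-1` psi a) => a b; have [ab ba] := psiP a b; split.
  move=> /ab[f Df ->]; exists (g \o f \o h).
    by move=> A /(continuous_Fsigma _ _ _ _ gc)/Df/(continuous_Fsigma _ _ _ _ hc).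
  by apply/funext => x; rewrite /preimage /mkset /= gK.
move=> [f Bf fE]; apply: ba; exists (h \o f \o g).
  by move=> A /(continuous_borel_set _ _ _ _ hc)/Bf/(continuous_borel_set _ _ _ _ gc).
have psiE c : psi c = g @^-1` (h @^-1` psi c).
  by apply/funext => y; rewrite /preimage /mkset gK.
by rewrite [LHS]psiE fE.
Qed.

(** Reducibility by [F] is squeezed between those by [G] and [H], so [psi] preserves and reflects
    the order; injectivity is antisymmetry of inclusion. *)
Lemma order_embeds_degrees (X : Type) (F G H : set (X -> X))
    (psi : set nat -> set X) :
  is_reducibility F -> G `<=` F -> F `<=` H ->
  (forall a b : set nat, (a `<=` b -> reducible G (psi a) (psi b)) /\
     (reducible H (psi a) (psi b) -> a `<=` b)) ->
  order_embeds (fun a b : set nat => a `<=` b) (@degree_le X F).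
Proof.
move=> [Fid Fcomp] GF FH psiP.
have redF a b : a `<=` b <-> reducible F (psi a) (psi b).
  have [ab ba] := psiP a b; split.
    by move=> /ab[f /GF Ff fE]; exists f.
  by move=> [f /FH Hf fE]; apply: ba; exists f.
have red_trans A B E : reducible F A B -> reducible F B E -> reducible F A E.
  by move=> [f Ff ->] [k Fk ->]; exists (k \o f) => //; exact: Fcomp.
have deg_refl A : degree_of F A A by split; exists id.
pose deg (a : set nat) : hierarchy F :=
  exist _ (degree_of F (psi a)) (ex_intro _ (psi a) erefl).
exists deg; split=> [a b e|a b].
  have eab : degree_of F (psi a) = degree_of F (psi b) := congr1 sval e.
  have [ba ab] : degree_of F (psi b) (psi a) by rewrite -eab.
  by apply/seteqP; split; exact/redF.
split=> [/redF ab|]; first by exists (psi a), (psi b); split => //=.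
move=> [A [B [[aA _] [_ Bb] AB]]]; apply/redF.
exact: red_trans aA (red_trans _ _ _ AB Bb).
Qed.

(** Singletons give the antichain, final segments of [nat] the descending chain. *)
Lemma order_embeds_powerset_very_bad (T : Type) (le : T -> T -> Prop) :
  order_embeds (fun a b : set nat => a `<=` b) le -> very_bad le.
Proof.
move=> [f [finj fle]]; split.
  exists (range (fun n : nat => f [set n])); split.
    apply/infiniteP.
    suff /inj_card_eq/card_eqPle[] :
      {in [set: nat] &, injective (fun n => f [set n])} by [].
    move=> n m _ _ /finj e; have : [set n] n by [].
    by rewrite e.
  move=> _ _ [n _ <-] [m _ <-] nm /fle /(_ n erefl) /= e.
  by apply: nm; rewrite e.
exists (fun n => f [set k | n <= k]) => n; split.
  by apply/fle => k /=; exact: ltnW.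
by move=> /fle /(_ n (leqnn n)) /=; rewrite ltnn.
Qed.

Theorem theorem6p5 (R : realType) (X : topologicalType)
    (polishX : polish_space R X) (uncountableX : ~ countable [set: X]) :
  (exists psi : set nat -> set X,
     forall a b : set nat,
       (a `<=` b -> reducible (@D2 X) (psi a) (psi b)) /\
       (reducible (@Bor X) (psi a) (psi b) -> a `<=` b)) /\
  (forall F : set (X -> X),
     is_reducibility F -> @D2 X `<=` F -> F `<=` @Bor X ->
     order_embeds (fun a b : set nat => a `<=` b) (@degree_le X F) /\
     very_bad (@degree_le X F)).
Proof.
have psiP := reducibility_embedding R X polishX uncountableX.
split=> // F redF DF FB; have [psi {}psiP] := psiP.
have emb := order_embeds_degrees X F (@D2 X) (@Bor X) psi redF DF FB psiP.
by split => //; exact: order_embeds_powerset_very_bad.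
Qed.
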